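(* Let $\alpha\in\mathbb{T}$ be irrational. Then for Lebesgue-almost every $t\in\mathbb{T}$, the group $E^2(a,t)$ of (finite) essential values of the cocycle $(a,t)$ equals $G=\{(s_1,s_2)\in\mathbb{Z}^2 \mid s_1\equiv s_2 \bmod 2\}$. In particular, for almost every $t\in\mathbb{T}$ the cocycle $(a,t)$ is regular.
   Context: $\mathbb{T}=[0,1)$ is the additive group $\mathbb{R}/\mathbb{Z}$ with Lebesgue (Haar) measure $\mu$, and $T_0x=x+\alpha \bmod 1$. Let $f:\mathbb{T}\to\mathbb{Z}$, $f(x)=1$ for $0\le x<\tfrac12$ and $f(x)=-1$ for $\tfrac12\le x<1$. For $n\ge1$ put $a_n(x)=\sum_{i=0}^{n-1}f(x+i\alpha)$, $a_0(x)=0$, and $a_n(x)=-a_{-n}(T_0^{n}x)$ for $n\le -1$. For $t\in\mathbb{T}$, the cocycle $(a,t):\mathbb{Z}\times\mathbb{T}\to\mathbb{Z}^2$ is $(a,t)(n,x)=(a_n(x),a_n(x+t))$. A pair $(k_1,k_2)\in\mathbb{Z}^2$ is an essential value of $(a,t)$ if for every measurable $A\subset\mathbb{T}$ with $\mu(A)>0$, $\mu\big(\bigcup_{n\in\mathbb{Z}}(A\cap T_0^{-n}A\cap\{x: a_n(x)=k_1\}\cap\{x: a_n(x+t)=k_2\})\big)>0$; $E^2(a,t)$ denotes the set of these (a closed subgroup of $\mathbb{Z}^2$). More generally, for a cocycle $c:\mathbb{Z}\times\mathbb{T}\to H$ into a countable discrete abelian group $H$ (with $c(n,x)=c_n(x)$),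 $h\in H$ is an essential value if the same condition holds with $\{c_n=h\}$, and $\infty$ (the point of the one-point compactification $H\cup\{\infty\}$) is an essential value if for every finite $K\subset H$ and every measurable $A$ with $\mu(A)>0$, $\mu\big(\bigcup_n (A\cap T_0^{-n}A\cap\{c_n\notin K\})\big)>0$. Let $(a,t)^*:\mathbb{Z}\times\mathbb{T}\to\mathbb{Z}^2/E^2(a,t)$ be the quotient cocycle. The cocycle $(a,t)$ is called regular if the set of essential values of $(a,t)^*$ in $(\mathbb{Z}^2/E^2(a,t))\cup\{\infty\}$ is exactly $\{0\}$. *)

(* Defs.v *)
From HB Require Import structures.
From mathcomp Require Import all_boot all_order all_algebra.
From mathcomp Require Import all_classical all_reals all_analysis.
From mathcomp Require Import measurable_realfun lra zify.

Set Implicit Arguments.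
Unset Strict Implicit.
Unset Printing Implicit Defensive.

Import Order.TTheory GRing.Theory Num.Theory.
Import numFieldNormedType.Exports.

Local Open Scope classical_set_scope.
Local Open Scope ring_scope.

(* Points of R / Z are represented by their representatives in [0, 1), and its
   Haar measure is the Lebesgue measure of R on subsets of [0, 1). *)
Definition circle (R : realType) : set R := `[0, 1[%classic.
Arguments circle R : clear implicits.

Definition rot (R : realType) (b x : R) : R :=
  x + b - (Num.floor (x + b))%:~R.

(* The n-th power of the rotation by alpha, n possibly negative; see rotz_iter
   and rotzK. *)
Definition rotz (R : realType) (alpha : R) (n : int) : R -> R :=
  rot (n%:~R * alpha).

Section essential_values.
Variables (R : realType) (alpha : R) (H : zmodType) (c : int -> R -> H).
Local Notation mu := (@lebesgue_measure R).

(* c plays the role of a cocycle over the rotation by alpha, with values in the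
   discrete group H. *)
Definition returns_in (P : set H) : Prop :=
  forall A : set R, measurable A -> A `<=` circle R -> (0 < mu A)%E ->
  (0 < mu (\bigcup_(n in [set: int])
             (A `&` rotz alpha n @^-1` A `&` [set x | P (c n x)])))%E.

Definition essential_values : set H := [set h | returns_in [set h]].

Definition essential_infty : Prop :=
  forall K : set H, finite_set K -> returns_in (~` K).

(* None stands for the point at infinity. *)
Definition extended_essential_values : set (option H) :=
  [set o | if o is Some h then essential_values h else essential_infty].

End essential_values.

Definition step (R : realType) (x : R) : int := if x < 1 / 2 then 1 else -1.

Definition step_sum (R : realType) (alpha : R) (n : nat) (x : R) : int :=
  \sum_(i < n) step (rotz alpha i x).

Definition cocycle_a (R : realType) (alpha : R) (n : int) (x : R) : int :=
  match n with
  | Posz m => step_sum alpha m x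
  | Negz m => - step_sum alpha m.+1 (rotz alpha n x)
  end.

Definition cocycle_at (R : realType) (alpha t : R) (n : int) (x : R) :
    int * int :=
  (cocycle_a alpha n x, cocycle_a alpha n (rot t x)).

Definition E2 (R : realType) (alpha t : R) : set (int * int) :=
  essential_values alpha (cocycle_at alpha t).

Section rotation_theory.
Variable R : realType.
Implicit Types (x b alpha : R).
Local Notation mu := (@lebesgue_measure R).

Lemma rot_circle b x : circle R (rot b x).
Proof.
rewrite /circle /rot /= in_itv /=.
have /andP[h1 h2] := floor_itv (x + b).
by move: h2; rewrite intrD => h2; apply/andP; split; lra.
Qed.

Lemma rot_eq b x y (m : int) : circle R y -> x + b = y + m%:~R -> rot b x = y.
Proof.
rewrite /circle /= in_itv /= => /andP[y0 y1] e; rewrite /rot e.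
rewrite (@floor_def _ _ m) ?addrK// intrD; apply/andP; split; lra.
Qed.

Lemma rot0 x : circle R x -> rot 0 x = x.
Proof. by move=> cx; apply: (@rot_eq _ _ _ 0) => //; rewrite !addr0. Qed.

Lemma rotD b b' x : rot b' (rot b x) = rot (b + b') x.
Proof.
apply: (@rot_eq _ _ _ (Num.floor (x + (b + b')) - Num.floor (x + b))).
  exact: rot_circle.
by rewrite /rot rmorphB /=; lra.
Qed.

Lemma rotz0 alpha x : circle R x -> rotz alpha 0 x = x.
Proof. by move=> cx; rewrite /rotz mul0r rot0. Qed.

Lemma rotzD alpha m n x : rotz alpha n (rotz alpha m x) = rotz alpha (m + n) x.
Proof. by rewrite /rotz rotD intrD mulrDl. Qed.

Lemma rotz_iter alpha (n : nat) x : circle R x ->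
  rotz alpha n x = iter n (rot alpha) x.
Proof.
move=> cx; elim: n => [|n /= <-]; first by rewrite rotz0.
by rewrite /rotz rotD -addn1 PoszD intrD mulrDl mul1r.
Qed.

Lemma rotzK alpha n x : circle R x -> rotz alpha (- n) (rotz alpha n x) = x.
Proof. by move=> cx; rewrite rotzD subrr rotz0. Qed.

Lemma rot_rotz alpha n b x : rot b (rotz alpha n x) = rotz alpha n (rot b x).
Proof. by rewrite /rotz !rotD addrC. Qed.

Lemma measurable_rot b : measurable_fun [set: R] (rot b).
Proof.
have mD : measurable_fun [set: R] (fun x : R => x + b).
  by apply: nondecreasing_measurable => // x y xy; rewrite lerD2r.
apply: measurable_funB => //; apply: nondecreasing_measurable => // x y xy.
by rewrite ler_int le_floor// lerD2r.
Qed.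

Lemma lebesgue_measure_shift b (A : set R) : measurable A ->
  mu ((fun x => x + b) @^-1` A) = mu A.
Proof.
move=> mA; rewrite -[LHS]/(pushforward mu
  ((fun x => x + b) : _ -> measurableTypeR R) A).
apply/esym/lebesgue_measure_unique => //=.
  by apply: nondecreasing_measurable => // x y xy; rewrite lerD2r.
move=> mD _ [[u v]] _ <-.
rewrite /pushforward /=.
have -> : (fun x => x + b) @^-1` `]u, v]%classic = `]u - b, v - b]%classic.
  by apply/seteqP; split=> x /=; rewrite !in_itv/= => /andP[h1 h2];
    apply/andP; split; lra.
rewrite !lebesgue_measure_itv/= !lte_fin ltrD2r.
by case: ifPn => // _; rewrite -!EFinD; congr EFin; lra.
Qed.

Lemma measurable_circle : measurable (circle R).
Proof. exact: measurable_itv. Qed.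

Lemma measurable_rot_preimage b (A : set R) : measurable A ->
  measurable (rot b @^-1` A).
Proof. by move=> mA; rewrite -[X in measurable X]setTI; exact: measurable_rot. Qed.

Lemma mu_gt0 (A : set R) : measurable A -> (0 < mu A)%E <-> ~ mu.-negligible A.
Proof.
move=> mA; split.
  move=> A0 /(negligibleP mu mA) A00; by rewrite A00 ltxx in A0.
move=> nA; rewrite lt0e measure_ge0 andbT; apply/eqP => A0; apply: nA.
exact/(negligibleP mu mA).
Qed.

Lemma rot_preimage_gt0 b (A : set R) : measurable A -> A `<=` circle R ->
  (0 < mu A)%E -> (0 < mu (circle R `&` rot b @^-1` A))%E.
Proof.
move=> mA Ac A0.
have mC : measurable (circle R `&` rot b @^-1` A).
  by apply: measurableI; [exact: measurable_circle|exact: measurable_rot_preimage].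
apply/mu_gt0 => // nC; move: A0; apply/negP; rewrite -leNgt measure_le0.
pose B k := (fun x => x + k) @^-1` (circle R `&` rot b @^-1` A).
pose b' := b - (Num.floor b)%:~R.
have negB k : mu.-negligible (B k).
  have mB : measurable (B k).
    rewrite -[X in measurable X]setTI.
    apply: (@nondecreasing_measurable _ setT (fun x : R => x + k)) => //.
    by move=> x y xy; rewrite lerD2r.
  have mC0 : mu (B k) = mu (circle R `&` rot b @^-1` A) by exact: lebesgue_measure_shift.
  apply/(negligibleP mu mB); apply: etrans mC0 _.
  exact/(negligibleP mu mC).
have := negligibleU (negB (- b')) (negB (1 - b')).
have /andP[f0 f1] := floor_itv b; rewrite intrD in f1.
move=> neg; apply/eqP/(negligibleP mu mA); apply: negligibleS neg => x Ax.
have cx := Ac _ Ax; have := cx; rewrite /circle /= in_itv /= => /andP[x0 x1].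
have [xb|xb] := leP b' x; [left|right]; rewrite /B /=; split.
- by rewrite /circle /= in_itv /=; rewrite /b' in xb *; lra.
- rewrite (_ : rot b _ = x)//; apply: (@rot_eq _ _ _ (Num.floor b)) => //.
  by rewrite /b'; lra.
- by rewrite /circle /= in_itv /=; rewrite /b' in xb *; lra.
- rewrite (_ : rot b _ = x)//; apply: (@rot_eq _ _ _ (Num.floor b + 1)) => //.
  by rewrite /b' intrD; lra.
Qed.

Lemma bigcup_int_gt0 (F : int -> set R) : (forall n, measurable (F n)) ->
  (0 < mu (\bigcup_(n in [set: int]) F n))%E <-> exists n, (0 < mu (F n))%E.
Proof.
move=> mF.
have mU : measurable (\bigcup_(n in [set: int]) F n).
  by apply: countable_bigcupT_measurable; [exact: countableP|exact: mF].
split=> [|[n Fn]]; last first.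
  apply: lt_le_trans Fn _; apply: le_measure; rewrite ?inE//; first exact: mF.
  by move=> x Fx; exists n.
move=> U0; apply: contrapT => /forallNP nF; move: U0.
pose F' k := if unpickle k is Some n then F n else set0.
move=> /(mu_gt0 mU); apply.
have -> : \bigcup_(n in [set: int]) F n = \bigcup_k F' k.
  apply/seteqP; split=> x [n _].
    by move=> Fnx; exists (pickle n) => //; rewrite /F' pickleK.
  by rewrite /F'; case: unpickle => // m Fmx; exists m.
apply: negligible_bigcup => k; rewrite /F'.
case: unpickle => [n|]; last exact: negligible_set0.
by apply: contrapT => h; apply: (nF n); apply/mu_gt0.
Qed.

End rotation_theory.

Section essential_subgroup.
Variables (R : realType) (alpha : R) (H : zmodType) (c : int -> R -> H).
Local Notation mu := (@lebesgue_measure R).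
Hypothesis cD : forall m n x, circle R x ->
  c (m + n) x = c m x + c n (rotz alpha m x).
Hypothesis cM : forall n h, measurable [set x | c n x = h].

Let c0 x : circle R x -> c 0 x = 0.
Proof.
move=> cx; have := cD 0 0 cx; rewrite rotz0// addr0 => e.
by apply: (addrI (c 0 x)); rewrite addr0 -e.
Qed.

Let cN n x : circle R x -> c (- n) (rotz alpha n x) = - c n x.
Proof.
move=> cx; apply: (addrI (c n x)); rewrite -cD// !subrr; exact: c0.
Qed.

Let ret A h n := A `&` rotz alpha n @^-1` A `&` [set x | c n x = h].

Let mret A h n : measurable A -> measurable (ret A h n).
Proof.
by move=> mA; apply: measurableI => //; apply: measurableI => //;
  exact: measurable_rot_preimage.
Qed.

Let essP h : essential_values alpha c h <-> forall A : set R, measurable A ->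
  A `<=` circle R -> (0 < mu A)%E -> exists n, (0 < mu (ret A h n))%E.
Proof.
split=> hh A mA Ac A0.
  have := hh A mA Ac A0.
  by move/(bigcup_int_gt0 (fun n => mret h n mA)).
by apply/(bigcup_int_gt0 (fun n => mret h n mA)); exact: hh.
Qed.

Lemma essential_values0 : essential_values alpha c 0.
Proof.
apply/essP => A mA Ac A0; exists 0; rewrite (_ : ret A 0 0 = A)//.
apply/seteqP; split=> x; first by case=> -[].
move=> Ax; have cx := Ac _ Ax; split; [split=> //|exact: c0].
by rewrite /= rotz0.
Qed.

Lemma essential_valuesD h k : essential_values alpha c h ->
  essential_values alpha c k -> essential_values alpha c (h + k).
Proof.
move=> /essP hh /essP hk; apply/essP => A mA Ac A0.
have [n n0] := hk A mA Ac A0.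
have Bc : ret A k n `<=` circle R by move=> x [[/Ac]].
have [m m0] := hh _ (mret k n mA) Bc n0.
exists (m + n); apply: lt_le_trans m0 _.
apply: le_measure; rewrite ?inE; [exact: mret (mret _ _ mA)|exact: mret|].
move=> x [[[[Ax _] _] [[_ An] kn]] hm]; split; first split=> //.
  by rewrite /= -rotzD.
by rewrite /= cD; [rewrite hm kn|exact: Ac].
Qed.

Lemma essential_valuesN h : essential_values alpha c h ->
  essential_values alpha c (- h).
Proof.
move=> /essP hh; apply/essP => A mA Ac A0.
have [n n0] := hh A mA Ac A0.
have Bc : ret A h n `<=` circle R by move=> x [[/Ac]].
exists (- n).
apply: lt_le_trans (rot_preimage_gt0 ((- n)%:~R * alpha) (mret h n mA) Bc n0) _.
apply: le_measure; rewrite ?inE; [|exact: mret|].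
  apply: measurableI; first exact: measurable_circle.
  by apply: measurable_rot_preimage; exact: mret.
move=> x [cx]; rewrite -/(rotz alpha (- n)) => -[[A1 A2] /= A3].
have xE : rotz alpha n (rotz alpha (- n) x) = x by rewrite rotzD addNr rotz0.
rewrite /= xE in A2; split=> //=.
by rewrite -{1}xE cN ?A3//; exact: rot_circle.
Qed.

End essential_subgroup.

Section cocycle_theory.
Variables (R : realType) (alpha : R).

Lemma cocycle_aS n x : circle R x ->
  cocycle_a alpha (n + 1) x = cocycle_a alpha n x + step (rotz alpha n x).
Proof.
move=> cx; case: n => m.
  by rewrite -PoszD addn1 /= /step_sum big_ord_recr.
rewrite [cocycle_a alpha (Negz m) x]/= {1}/step_sum big_ord_recl /=.
rewrite rotz0; last exact: rot_circle.
rewrite opprD addrAC addNr add0r.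
have -> : \sum_(i < m) step (rotz alpha (bump 0 i) (rotz alpha (Negz m) x)) =
    step_sum alpha m (rotz alpha (- m%:Z) x).
  rewrite /step_sum; apply: eq_bigr => i _; congr step.
  rewrite !rotzD; congr (rotz _ _ _).
  by rewrite /bump /= NegzE; lia.
case: m => [|m]; first by rewrite /= /step_sum !big_ord0 oppr0.
by have -> : Negz m.+1 + 1 = Negz m by lia.
Qed.

Lemma cocycle_a0 x : cocycle_a alpha 0 x = 0.
Proof. by rewrite /= /step_sum big_ord0. Qed.

Lemma cocycle_aD m n x : circle R x ->
  cocycle_a alpha (m + n) x =
  cocycle_a alpha m x + cocycle_a alpha n (rotz alpha m x).
Proof.
move=> cx; have cy : circle R (rotz alpha m x) by exact: rot_circle.
have stepE k : cocycle_a alpha (m + (k + 1)) x -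
    cocycle_a alpha (k + 1) (rotz alpha m x) =
    cocycle_a alpha (m + k) x - cocycle_a alpha k (rotz alpha m x).
  by rewrite addrA (cocycle_aS _ cx) (cocycle_aS _ cy) rotzD opprD addrACA subrr addr0.
suff : cocycle_a alpha (m + n) x - cocycle_a alpha n (rotz alpha m x) =
    cocycle_a alpha m x by move/(canRL (subrK _)).
elim/int_ind: n => [|n <-|n <-].
- by rewrite addr0 cocycle_a0 subr0.
- by rewrite -(stepE n) -addn1 PoszD.
- by rewrite -(stepE (- n.+1%:Z)) (_ : - n.+1%:Z + 1 = - n%:Z)//; lia.
Qed.

Lemma measurable_step : measurable_fun [set: R] (fun x => (step x)%:~R : R).
Proof.
rewrite [X in measurable_fun _ X](_ : _ =
    fun x : R => if x < 1 / 2 then 1 else -1); last first.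
  by apply/funext => x; rewrite /step; case: ifP.
by apply: measurable_fun_ifT => //; exact: measurable_fun_ltr.
Qed.

Lemma measurable_cocycle_a n :
  measurable_fun [set: R] (fun x => (cocycle_a alpha n x)%:~R : R).
Proof.
have mS m : measurable_fun [set: R] (fun x => (step_sum alpha m x)%:~R : R).
  rewrite [X in measurable_fun _ X](_ : _ =
      fun x : R => \sum_(i < m) (step (rotz alpha i x))%:~R); last first.
    by apply/funext => x; rewrite /step_sum rmorph_sum.
  apply: measurable_sum => i.
  exact: (measurableT_comp measurable_step (measurable_rot _)).
case: n => m /=; first exact: mS.
rewrite [X in measurable_fun _ X](_ : _ =
    \- (fun x => (step_sum alpha m.+1 (rotz alpha (Negz m) x))%:~R : R)).
  apply: measurable_funN.
  exact: (measurableT_comp (mS m.+1) (measurable_rot _)).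
by apply/funext => x; rewrite /= rmorphN.
Qed.

Variable t : R.

Lemma cocycle_atD m n x : circle R x ->
  cocycle_at alpha t (m + n) x =
  cocycle_at alpha t m x + cocycle_at alpha t n (rotz alpha m x).
Proof.
move=> cx; rewrite /cocycle_at !cocycle_aD ?rot_rotz//; exact: rot_circle.
Qed.

Lemma measurable_cocycle_at n h : measurable [set x | cocycle_at alpha t n x = h].
Proof.
case: h => h1 h2.
rewrite (_ : [set x | _] =
  (fun x => (cocycle_a alpha n x)%:~R : R) @^-1` [set h1%:~R] `&`
  ((fun x => (cocycle_a alpha n x)%:~R : R) \o rot t) @^-1` [set h2%:~R]).
  apply: measurableI; rewrite -[X in measurable X]setTI.
    exact: measurable_cocycle_a.
  exact: (measurableT_comp (measurable_cocycle_a n) (measurable_rot t)).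
apply/seteqP; split=> x /=.
  by rewrite /cocycle_at => -[-> ->].
by move=> [/intr_inj e1 /intr_inj e2]; rewrite /cocycle_at e1 e2.
Qed.

Definition E2_pred : {pred int * int} := mem (E2 alpha t).

Lemma E2_zmod_closed : zmod_closed E2_pred.
Proof.
have cD := cocycle_atD; have cM := measurable_cocycle_at.
split=> [|h k]; rewrite /E2_pred !inE; first exact: essential_values0.
move=> hh hk; apply: essential_valuesD => //; exact: essential_valuesN.
Qed.

HB.instance Definition _ :=
  GRing.isZmodClosed.Build (int * int)%type E2_pred E2_zmod_closed.

(* Despite its name, ideal_quot is the quotient of a Z-module by a subgroup. *)
Definition quotient_E2 : zmodType := {ideal_quot E2_pred}.

Definition quotient_cocycle (n : int) (x : R) : quotient_E2 :=
  (\pi_({ideal_quot E2_pred}) (cocycle_at alpha t n x))%qT.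

Definition regular : Prop :=
  extended_essential_values alpha quotient_cocycle = [set Some 0].

End cocycle_theory.

(* Main.v *)
(* Every irrational alpha has infinitely many fractions p / q with q odd and
   q |q alpha - p| <= 1/2.  For such q the up-jumps and the down-jumps of a_q
   interlace, so a_q only takes the values 1 and -1, each with probability 1/2
   because a_q (x + 1/2) = - a_q x.  Since q alpha is close to 0 modulo 1, the
   level sets of a_q are almost invariant under the rotation, and by ergodicity
   they spread evenly: if {a_q = k1, a_q (. + t) = k2} has measure bounded below
   along such q, then (k1, k2) is an essential value of (a, t).  Let m_q t be this
   measure, for k1 and k2 in {1, -1}.  The set of t with m_q t -> 0 is invariant
   under the rotation, and it cannot have full measure because the integral of m_q
   is 1/2 * 1/2; hence it is null.  So (1, 1) and (1, -1) are essential values for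
   almost every t, and they generate G; the converse inclusion is a parity remark,
   which also makes the quotient cocycle vanish. *)
From mathcomp Require Import all_boot all_order all_algebra.
From mathcomp Require Import all_classical all_reals all_analysis.
From mathcomp Require Import measurable_realfun ring lra zify.
Require Import Defs.
Import Order.TTheory GRing.Theory Num.Theory.
Import numFieldNormedType.Exports.
Local Open Scope classical_set_scope.
Local Open Scope ring_scope.

Set Implicit Arguments.
Unset Strict Implicit.
Unset Printing Implicit Defensive.

(** * Rational approximation with odd denominators *)

Section odd_approximation.
Variables (R : realType) (alpha : R).
Hypotheses (halpha : circle R alpha) (alpha_irr : irrational alpha).

Let err (q p : int) : R := q%:~R * alpha - p%:~R.

Lemma irrational_err_neq0 (q p : int) : 0 < q -> q%:~R * alpha - p%:~R != 0.
Proof.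
move=> q0; apply/eqP => /subr0_eq e; apply: alpha_irr.
have q0R : (q%:~R : R) != 0 by rewrite intr_eq0 gt_eqF.
exists (p%:~R / q%:~R) => //.
rewrite rmorph_div /= ?unitfE ?intr_eq0 ?gt_eqF// !ratr_int -e.
by rewrite mulrC mulKf.
Qed.

(* Two vectors (2 k + 1, p) with odd first entry, forming an oriented basis of
   Z^2 and lying on either side of the line of slope alpha. *)
Let basis (k1 p1 k2 p2 : int) := [/\ 0 <= k1, 0 <= k2,
  p2 * (2 * k1 + 1) - p1 * (2 * k2 + 1) = 1,
  0 < err (2 * k1 + 1) p1 & err (2 * k2 + 1) p2 < 0].

(* With m the sum of the two vectors, whose first entry is even, add multiples of
   m to the vector lying on the other side of the line until the line is crossed:
   the last two vectors so obtained are the new basis. *)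
Let basis_next k1 p1 k2 p2 : basis k1 p1 k2 p2 ->
  exists k1' p1' k2' p2', basis k1' p1' k2' p2' /\ k1 + k2 < k1' + k2'.
Proof.
case=> k10 k20 det e1 e2.
set e1' := err _ _ in e1; set e2' := err _ _ in e2.
have /eqP em0 : e1' + e2' != 0.
  rewrite (_ : _ + _ = err (2 * (k1 + k2 + 1)) (p1 + p2)).
    by apply: irrational_err_neq0; lia.
  by rewrite /e1' /e2' /err; ring.
have [em|em|] := ltgtP (e1' + e2') 0; last by move/em0.
  (* Here m has negative error, and [K] is the largest number of copies of m that keeps the error of
     the first vector nonnegative; irrationality makes that error positive. *)
  pose K := Num.floor (e1' / - (e1' + e2')).
  have /andP[K1 K2] := floor_itv (e1' / - (e1' + e2')).
  rewrite -/K in K1 K2.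
  rewrite ler_pdivlMr in K1; last lra.
  rewrite ltr_pdivrMr in K2; last lra.
  have K0 : 0 <= K by rewrite floor_ge0 divr_ge0; lra.
  rewrite intrD in K2.
  have Km0 : 0 <= K * (k1 + k2 + 1) by apply: mulr_ge0 => //; lia.
  have /eqP eK0 : err (2 * (k1 + K * (k1 + k2 + 1)) + 1) (p1 + K * (p1 + p2)) != 0.
    by apply: irrational_err_neq0; nia.
  have eKE : err (2 * (k1 + K * (k1 + k2 + 1)) + 1) (p1 + K * (p1 + p2)) =
      e1' + K%:~R * (e1' + e2').
    by rewrite /e1' /e2' /err; ring.
  have eK1E : err (2 * (k1 + (K + 1) * (k1 + k2 + 1)) + 1)
      (p1 + (K + 1) * (p1 + p2)) = e1' + (K%:~R + 1) * (e1' + e2').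
    by rewrite /e1' /e2' /err; ring.
  exists (k1 + K * (k1 + k2 + 1)), (p1 + K * (p1 + p2)),
    (k1 + (K + 1) * (k1 + k2 + 1)), (p1 + (K + 1) * (p1 + p2)).
  split; last by lia.
  split; [lia|lia| | |].
  - by rewrite -[RHS]det; ring.
  - by rewrite eKE in eK0 *; lra.
  - by rewrite eK1E; lra.
pose K := Num.floor (- e2' / (e1' + e2')).
have /andP[K1 K2] := floor_itv (- e2' / (e1' + e2')).
rewrite -/K in K1 K2.
rewrite ler_pdivlMr in K1; last lra.
rewrite ltr_pdivrMr in K2; last lra.
have K0 : 0 <= K by rewrite floor_ge0 divr_ge0; lra.
rewrite intrD in K2.
have Km0 : 0 <= K * (k1 + k2 + 1) by apply: mulr_ge0 => //; lia.
have /eqP eK0 : err (2 * (k2 + K * (k1 + k2 + 1)) + 1) (p2 + K * (p1 + p2)) != 0.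
  by apply: irrational_err_neq0; nia.
have eKE : err (2 * (k2 + K * (k1 + k2 + 1)) + 1) (p2 + K * (p1 + p2)) =
    e2' + K%:~R * (e1' + e2').
  by rewrite /e1' /e2' /err; ring.
have eK1E : err (2 * (k2 + (K + 1) * (k1 + k2 + 1)) + 1)
    (p2 + (K + 1) * (p1 + p2)) = e2' + (K%:~R + 1) * (e1' + e2').
  by rewrite /e1' /e2' /err; ring.
exists (k2 + (K + 1) * (k1 + k2 + 1)), (p2 + (K + 1) * (p1 + p2)),
  (k2 + K * (k1 + k2 + 1)), (p2 + K * (p1 + p2)).
split; last by lia.
split; [lia|lia| | |].
- by rewrite -[RHS]det; ring.
- by rewrite eK1E; lra.
- by rewrite eKE in eK0 *; lra.
Qed.

Let basis_large (N : nat) : exists k1 p1 k2 p2, basis k1 p1 k2 p2 /\ N%:Z <= k1 + k2.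
Proof.
elim: N => [|N [k1 [p1 [k2 [p2 [/basis_next h kN]]]]]].
  move: halpha; rewrite /circle /= in_itv /= => /andP[a0 a1].
  (* The starting vectors (1, 0) and (1, 1) have errors [alpha] and [alpha - 1]. *)
  exists 0, 0, 0, 1; split => //; split => //; rewrite /err ?mulr0 ?add0r.
    have := @irrational_err_neq0 1 0 isT; lra.
  by lra.
have [k1' [p1' [k2' [p2' [? ?]]]]] := h.
by exists k1', p1', k2', p2'; split => //; lia.
Qed.

(** For a basis with first entries q1, q2 and absolute errors e1, e2, the determinant gives q2 e1 +
    q1 e2 = 1. Hence q1 e1 and q2 e2 cannot both exceed 1/2, and each error is at most the inverse
    of the other first entry. The vector not chosen supplies the Bezout coefficients. *)
Lemma odd_approximation (eta : R) : 0 < eta -> exists (q : nat) (p u v : int),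
  [/\ odd q, u * p + v * q = 1, q%:R * `|q%:R * alpha - p%:~R| <= 1 / 2
    & 0 < `|q%:R * alpha - p%:~R| < eta].
Proof.
move=> eta0; pose N := (Num.trunc (eta^-1)).+1.
have NE : eta^-1 < N%:R by rewrite /N truncnS_gt.
have NE1 : 1 < eta * N%:R by rewrite mulrC -ltr_pdivrMr// mul1r.
have [k1 [p1 [k2 [p2 [[k10 k20 det e1 e2] kN]]]]] := basis_large N.
have q10 : (0 : R) < (2 * k1 + 1)%:~R by rewrite ltr0z; lia.
have q20 : (0 : R) < (2 * k2 + 1)%:~R by rewrite ltr0z; lia.
have detR : (2 * k2 + 1)%:~R * err (2 * k1 + 1) p1 +
    (2 * k1 + 1)%:~R * - err (2 * k2 + 1) p2 = 1.
  have := congr1 (fun z : int => z%:~R : R) det; rewrite /err /= => detE.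
  by rewrite -[RHS]detE; ring.
have sN : N%:R <= (2 * k1 + 1)%:~R :> R \/ N%:R <= (2 * k2 + 1)%:~R :> R.
  have [k12|k12] := leP k1 k2; [right|left];
  by rewrite -[N%:R]/(N%:Z%:~R) ler_int; lia.
(* [y] is the first entry of the vector not chosen: [y * e <= 1] keeps the error below [eta] even
   when only [y] reaches [N]. *)
have main (k p u v : int) (x y e : R) : 0 <= k -> u * p + v * (2 * k + 1) = 1 ->
  `|(2 * k + 1)%:~R * alpha - p%:~R| = e -> 0 < e ->
  (2 * k + 1)%:~R = x -> x * e <= 1 / 2 -> 0 < y -> y * e <= 1 ->
  N%:R <= x \/ N%:R <= y -> exists (q : nat) (p u v : int),
  [/\ odd q, u * p + v * q = 1, q%:R * `|q%:R * alpha - p%:~R| <= 1 / 2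
    & 0 < `|q%:R * alpha - p%:~R| < eta].
  move=> k0 uv eE e0 xE xe y0 ye xyN; exists (absz (2 * k + 1)), p, u, v.
  have qE : ((absz (2 * k + 1))%:Z = 2 * k + 1 :> int).
    by rewrite gez0_abs//; clear -k0; lia.
  have qER : ((absz (2 * k + 1))%:R = (2 * k + 1)%:~R :> R).
    by rewrite -[LHS]/((absz (2 * k + 1))%:Z%:~R) qE.
  split.
  - by clear -k0; lia.
  - by rewrite qE.
  - by rewrite qER eE xE.
  - have : N%:R * e < N%:R * eta.
      case: xyN => xyN; have := ler_wpM2r (ltW e0) xyN; lra.
    by rewrite qER eE e0 /= ltr_pM2l// ltr0n.
have [h|h] := leP ((2 * k1 + 1)%:~R * err (2 * k1 + 1) p1) (1 / 2).
  apply: (main k1 p1 (- (2 * k2 + 1)) p2 (2 * k1 + 1)%:~R (2 * k2 + 1)%:~R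
    (err (2 * k1 + 1) p1)) => //.
  - by rewrite -[RHS]det; ring.
  - by rewrite gtr0_norm.
  - have e2' : 0 < - err (2 * k2 + 1) p2 by rewrite oppr_gt0.
    have := mulr_gt0 q10 e2'; lra.
apply: (main k2 p2 (2 * k1 + 1) (- p1) (2 * k2 + 1)%:~R (2 * k1 + 1)%:~R
  (- err (2 * k2 + 1) p2)) => //.
- by rewrite -[RHS]det; ring.
- by rewrite ltr0_norm.
- by rewrite oppr_gt0.
- rewrite leNgt; apply/negP => h2.
  move: detR q10 q20 h h2.
  move: (2 * k1 + 1)%:~R (2 * k2 + 1)%:~R (err _ _) (- err _ _) => a b x y.
  move=> d a0 b0 ax bY.
  (* a b = a b (b x + a y) = b^2 (a x) + a^2 (b y) > (a^2 + b^2) / 2 *)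
  have sq := sqr_ge0 (a - b); rewrite expr2 in sq.
  have : b * b * (1 / 2) < b * b * (a * x) by rewrite ltr_pM2l// mulr_gt0.
  have : a * a * (1 / 2) < a * a * (b * y) by rewrite ltr_pM2l// mulr_gt0.
  have : a * b * (b * x + a * y) = a * b by rewrite d mulr1.
  lra.
- have := mulr_gt0 q20 e1; lra.
- by case: sN; [right|left].
Qed.

End odd_approximation.

(** * Birkhoff sums over odd denominators *)

Section floor_sums.
Variable R : realType.
Implicit Types x y : R.

(** The difference floor (y + 1/2) - floor y is the indicator of fractional part at least 1/2. In
    this form a Birkhoff sum becomes a difference of two values of a monotone floor sum. *)
Lemma step_floor b x :
  step (rot b x) = 1 - 2 * (Num.floor (x + b + 1 / 2) - Num.floor (x + b)).
Proof.
rewrite /step /rot; have /andP[f0 f1] := floor_itv (x + b).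
rewrite intrD in f1.
set m := Num.floor (x + b) in f0 f1 *.
case: ltP => h.
  by rewrite (@floor_def _ (x + b + 1 / 2) m) ?subrr ?mulr0 ?subr0// intrD;
    apply/andP; split; lra.
rewrite (@floor_def _ (x + b + 1 / 2) (m + 1)); first lia.
by rewrite !intrD; apply/andP; split; lra.
Qed.

Variables (q : nat) (p : int).
Hypothesis q_gt0 : (0 < q)%N.

Let rational_sum x : int := \sum_(i < q) Num.floor (x + i%:R * (p%:~R / q%:R)).

Let rational_sum_le x y : x <= y -> rational_sum x <= rational_sum y.
Proof. by move=> xy; apply: ler_sum => i _; rewrite le_floor// lerD2r. Qed.

(* Adding p / q to x shifts the index of the sum, and adding q / q adds 1 to each
   term; by Bezout the translation by s / q then adds s for every integer s. *)
Let shift_p x : rational_sum (x + p%:~R / q%:R) = rational_sum x + p.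
Proof.
have q0 : q%:R != 0 :> R by rewrite pnatr_eq0 -lt0n.
pose g i := Num.floor (x + i%:R * (p%:~R / q%:R)).
have -> : rational_sum (x + p%:~R / q%:R) = \sum_(i < q) g i.+1.
  apply: eq_bigr => i _; rewrite /g; congr Num.floor.
  by rewrite -natr1; ring.
apply/eqP; rewrite addrC -subr_eq -[rational_sum x]/(\sum_(i < q) g i) -sumrB.
rewrite -(big_mkord predT (fun i => g i.+1 - g i)) telescope_sumr//.
rewrite /g mul0r addr0 mulrCA divff// mulr1 floorDrz ?intr_int// intrKfloor.
by rewrite addrC addKr.
Qed.

Let shift_q x : rational_sum (x + q%:R / q%:R) = rational_sum x + q.
Proof.
rewrite divff ?pnatr_eq0 -?lt0n// /rational_sum.
have -> : q%:Z = \sum_(i < q) (1 : int) by rewrite sumr_const card_ord natz.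
rewrite -big_split /=; apply: eq_bigr => i _.
by rewrite addrAC floorDrz ?floor1// intr1.
Qed.

Let shifts (s : int) := forall x,
  rational_sum (x + s%:~R / q%:R) = rational_sum x + s.

Let shiftsD s1 s2 : shifts s1 -> shifts s2 -> shifts (s1 + s2).
Proof. by move=> h1 h2 x; rewrite intrD mulrDl addrA h2 h1 addrA. Qed.

Let shiftsN s : shifts s -> shifts (- s).
Proof.
move=> h x; apply: (addIr s); rewrite -h addrNK intrN mulNr.
by rewrite addrNK.
Qed.

Let shiftsM s1 s2 : shifts s1 -> shifts (s2 * s1).
Proof.
move=> h; have hn (n : nat) : shifts (n%:Z * s1).
  elim: n => [x|n IH]; first by rewrite mul0r mul0r !addr0.
  by rewrite intS mulrDl mul1r; exact: shiftsD.
by case: s2 => n; [exact: hn|rewrite NegzE mulNr; apply: shiftsN; exact: hn].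
Qed.

Let shift (u v s : int) x : u * p + v * q = 1 ->
  rational_sum (x + s%:~R / q%:R) = rational_sum x + s.
Proof.
move=> uv; suff : shifts (s * (u * p + v * q)) by rewrite uv mulr1; exact.
by apply: shiftsM; apply: shiftsD; apply: shiftsM; [exact: shift_p|exact: shift_q].
Qed.

(** Write q = 2 h + 1, so that 1/2 = h/q + 1/(2q). Replacing [alpha] by p/q moves each of the q
    points by at most 1/(2q), which traps the floor sum [S] between values of [rational_sum]. Hence
    S (x + 1/2) - S x is h or h + 1, and the Birkhoff sum q - 2 (S (x + 1/2) - S x) is 1 or -1. *)
Lemma step_sum_odd alpha (u v : int) x : odd q -> u * p + v * q = 1 ->
  q%:R * `|q%:R * alpha - p%:~R| <= 1 / 2 ->
  step_sum alpha q x = 1 \/ step_sum alpha q x = -1.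
Proof.
move=> oq uv dq; have q0 : 0 < q%:R :> R by rewrite ltr0n.
have q0' : 0 < q%:R^-1 :> R by rewrite invr_gt0.
pose d := alpha - p%:~R / q%:R.
pose S y := \sum_(i < q) Num.floor (y + i%:R * alpha).
have -> : step_sum alpha q x = q%:Z - 2 * (S (x + 1 / 2) - S x).
  rewrite /step_sum (eq_bigr _ (fun i _ => step_floor _ _)) sumrB -mulr_sumr.
  rewrite sumrB sumr_const card_ord; congr (_ - 2 * (_ - _)).
    exact: natz.
  by apply: eq_bigr => i _; rewrite addrAC.
have [h hE] : exists h : nat, q = (2 * h + 1)%N by exists q./2; lia.
suff : S x + h <= S (x + 1 / 2) <= S x + h + 1.
  by move=> /andP[s1 s2]; rewrite hE; lia.
have half : 1 / 2 = h%:R / q%:R + q%:R^-1 / 2 :> R.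
  have := divff (lt0r_neq0 q0).
  have {1}-> : q%:R = 2 * h%:R + 1 :> R by rewrite hE natrD natrM.
  by lra.
have d_le : `|d| <= q%:R^-1 / q%:R / 2.
  have -> : d = (q%:R * alpha - p%:~R) / q%:R.
    by rewrite mulrBl mulrAC divff ?gt_eqF// mul1r.
  rewrite normrM (ger0_norm (ltW q0')) [leRHS]mulrAC ler_pM2r//.
  by rewrite -(ler_pM2l q0) mulrA divff ?gt_eqF.
have id_le (i : 'I_q) : i%:R * `|d| <= q%:R^-1 / 2.
  apply: (@le_trans _ _ (q%:R * (q%:R^-1 / q%:R / 2))).
    by apply: ler_pM => //; rewrite ?ler_nat// ltnW.
  by rewrite !mulrA divff ?gt_eqF// mul1r.
have SE y : S y = \sum_(i < q) Num.floor (y + i%:R * d + i%:R * (p%:~R / q%:R)).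
  by apply: eq_bigr => i _; congr Num.floor; rewrite /d; ring.
have shift1 y (s : nat) :
    rational_sum (y + s%:R / q%:R) = rational_sum y + s.
  by rewrite -[s%:R]/(s%:~R) (shift _ _ uv).
(* The sign of [d] decides on which side of [rational_sum] the sum [S] lies. The slack 1/(2q) and
   the remainder 1/(2q) of the half turn add up to one full shift 1/q, or cancel. *)
have [d0|d0] := leP 0 d.
  have S_ge y : rational_sum y <= S y.
    rewrite SE; apply: ler_sum => i _; rewrite le_floor// !lerD2r lerDl.
    by rewrite mulr_ge0.
  have S_le y : S y <= rational_sum (y + q%:R^-1 / 2).
    rewrite SE; apply: ler_sum => i _; rewrite le_floor// lerD2r lerD2l.
    by have := id_le i; rewrite ger0_norm.
  have := S_ge x; have := S_le x.
  have := S_ge (x + 1 / 2); have := S_le (x + 1 / 2).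
  have -> : x + 1 / 2 + q%:R^-1 / 2 = x + h.+1%:R / q%:R.
    by rewrite half -[h.+1%:R]natr1; lra.
  have -> : x + 1 / 2 = x + q%:R^-1 / 2 + h%:R / q%:R by rewrite half; lra.
  rewrite !shift1; lia.
have S_le y : S y <= rational_sum y.
  rewrite SE; apply: ler_sum => i _; rewrite le_floor// !lerD2r gerDl.
  by rewrite mulr_ge0_le0// ltW.
have S_ge y : rational_sum (y - q%:R^-1 / 2) <= S y.
  rewrite SE; apply: ler_sum => i _; rewrite le_floor// lerD2r lerD2l.
  by have := id_le i; rewrite ltr0_norm// mulrN lerNl.
have := S_ge x; have := S_le x.
have := S_ge (x + 1 / 2); have := S_le (x + 1 / 2).
have -> : x + 1 / 2 - q%:R^-1 / 2 = x + h%:R / q%:R.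
  by rewrite half; lra.
have -> : x + 1 / 2 = x - q%:R^-1 / 2 + h.+1%:R / q%:R.
  by rewrite half -[h.+1%:R]natr1; lra.
rewrite !shift1; lia.
Qed.

End floor_sums.

(** * Lebesgue measure on the circle *)

Section circle_measure.
Variable R : realType.
Local Notation mu := (@lebesgue_measure R).
Implicit Types (A B C : set R) (b s x : R).

(** Real values allow linear arithmetic; on measurable sets [fine] loses nothing, since the circle
    has measure 1. *)
Definition circle_measure A : R := fine (mu (circle R `&` A)).
Local Notation lam := circle_measure.

Let mC A : measurable A -> measurable (circle R `&` A).
Proof. by move=> mA; apply: measurableI => //; exact: measurable_circle. Qed.

Lemma circleP x : circle R x <-> 0 <= x /\ x < 1.
Proof. by rewrite /circle /= in_itv /=; split=> /andP. Qed.

Let mu_circle : mu (circle R) = 1%E.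
Proof. by rewrite /circle lebesgue_measure_itv /= lte01 sube0. Qed.

Lemma circle_measureE A : measurable A -> mu (circle R `&` A) = (lam A)%:E.
Proof.
move=> mA; rewrite fineK// ge0_fin_numE//.
apply: (@le_lt_trans _ _ (mu (circle R))); last by rewrite mu_circle ltry.
by apply: le_measure; rewrite ?inE; [exact: mC|exact: measurable_circle|].
Qed.

Lemma circle_measureT : lam setT = 1.
Proof. by rewrite /lam setIT mu_circle. Qed.

Lemma circle_measure_ge0 A : 0 <= lam A.
Proof. by rewrite fine_ge0. Qed.

Lemma circle_measure_le A B : measurable A -> measurable B ->
  (forall x, circle R x -> A x -> B x) -> lam A <= lam B.
Proof.
move=> mA mB AB; rewrite -lee_fin -!circle_measureE//.
by apply: le_measure; rewrite ?inE; [exact: mC..|move=> x [cx /AB]; split; auto].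
Qed.

Lemma eq_circle_measure A B : (forall x, circle R x -> A x <-> B x) -> lam A = lam B.
Proof.
move=> AB; congr (fine (mu _)); apply/seteqP; split=> x [cx];
by move=> /(AB x cx).
Qed.

Lemma circle_measure_le1 A : measurable A -> lam A <= 1.
Proof. by move=> mA; rewrite -circle_measureT; exact: circle_measure_le. Qed.

Lemma circle_measureID A B : measurable A -> measurable B ->
  lam A = lam (A `&` B) + lam (A `\` B).
Proof.
move=> mA mB; apply: EFin_inj; rewrite EFinD -!circle_measureE//; last 2 first.
- exact: measurableD.
- exact: measurableI.
by rewrite setIA setIDA addeC -measureDI//; exact: mC.
Qed.

Lemma circle_measureU A B : measurable A -> measurable B ->
  lam (A `|` B) <= lam A + lam B.
Proof.
move=> mA mB; rewrite -lee_fin EFinD -!circle_measureE//; last exact: measurableU.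
by rewrite setIUr; apply: measureU2; exact: mC.
Qed.

Lemma circle_measure_gt0 A : measurable A ->
  (0 < mu (circle R `&` A))%E = (0 < lam A).
Proof. by move=> mA; rewrite circle_measureE// lte_fin. Qed.

Lemma rotDint b (m : int) x : rot (b + m%:~R) x = rot b x.
Proof. by rewrite /rot addrA floorDrz ?intr_int// intrKfloor intrD; ring. Qed.

Lemma rot_addr b x : rot b x = rot 0 (x + b).
Proof. by rewrite /rot addr0. Qed.

(** Reduce [b] to [c] in [0, 1) and cut the set at [c]: the preimage is the disjoint union of a
    translate of each piece, without and with wrap-around. *)
Lemma circle_measure_rot b A : measurable A -> lam (rot b @^-1` A) = lam A.
Proof.
move=> mA; pose c := b - (Num.floor b)%:~R.
have -> : rot b @^-1` A = rot c @^-1` A.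
  by apply/funext => x; rewrite /preimage /= -(rotDint c (Num.floor b)) subrK.
have /andP[c0 c1] : 0 <= c < 1.
  by have /andP[f0 f1] := floor_itv b; rewrite intrD in f1; rewrite /c; lra.
pose X1 := circle R `&` A `&` `[c, +oo[%classic.
pose X2 := circle R `&` A `\` `[c, +oo[%classic.
have mX1 : measurable X1 by apply: measurableI; [exact: mC|exact: measurable_itv].
have mX2 : measurable X2 by apply: measurableD; [exact: mC|exact: measurable_itv].
have mshift k X : measurable X -> measurable ((fun x : R => x + k) @^-1` X).
  move=> mX; rewrite -[X in measurable X]setTI.
  apply: (@nondecreasing_measurable _ setT (fun x : R => x + k)) => //.
  by move=> x y xy; rewrite lerD2r.
have rot_small x : circle R x -> x + c < 1 -> rot c x = x + c.
  move=> /circleP[x0 x1] xc; apply: (@rot_eq _ _ _ _ 0); last by rewrite addr0.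
  by apply/circleP; split; lra.
have rot_large x : circle R x -> 1 <= x + c -> rot c x = x + (c - 1).
  move=> /circleP[x0 x1] xc; apply: (@rot_eq _ _ _ _ 1); last by lra.
  by apply/circleP; split; lra.
rewrite /lam (_ : circle R `&` rot c @^-1` A =
    ((fun x => x + c) @^-1` X1) `|` ((fun x => x + (c - 1)) @^-1` X2)).
  rewrite measureU; [|exact: mshift|exact: mshift|].
    congr fine; rewrite (measureDI mu (mC mA) (measurable_itv `[c, +oo[)) addeC.
    by congr (_ + _)%E; exact: lebesgue_measure_shift.
  apply/seteqP; split=> // x [[[/circleP[_ xc] _] _]].
  by move=> [[/circleP[xc1 _] _] _]; exfalso; lra.
apply/seteqP; split=> x.
  move=> [cx Ax]; have /circleP[x0 x1] := cx.
  have [xc|xc] := ltP (x + c) 1; [left|right].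
    rewrite /preimage /= -(rot_small x cx xc); split.
      by split=> //; exact: rot_circle.
    by rewrite /= rot_small// in_itv /= andbT; lra.
  rewrite /preimage /= -(rot_large x cx xc); split.
    by split=> //; exact: rot_circle.
  by rewrite /= rot_large// in_itv /= andbT; apply/negP; rewrite -ltNge; lra.
move=> [] [[/circleP[x0 x1] Ax]]; rewrite /= in_itv /= andbT.
  move=> xc; have cx : circle R x by apply/circleP; split; lra.
  by split=> //=; rewrite rot_small.
move=> /negP; rewrite -ltNge => xc.
have cx : circle R x by apply/circleP; split; lra.
by split=> //=; rewrite rot_large//; lra.
Qed.

(** Regularity puts the set between a compact [K] and an open [U] up to small measure, and by
    compactness all small translates of [K] stay in [U]. *)
Lemma circle_measure_rotD A eps : measurable A -> 0 < eps ->
  exists2 eta, 0 < eta &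
    forall s, `|s| < eta -> lam (A `\` rot s @^-1` A) < eps.
Proof.
(* Working inside the open interval excludes wrap-around: if [x + s] lies there, it equals
   [rot s x]. Only the point 0 is lost. *)
move=> mA eps0; pose C := A `&` `]0, 1[%classic.
have mC' : measurable C by apply: measurableI.
have Cfin : (mu C < +oo)%E.
  apply: (@le_lt_trans _ _ (mu (circle R))); last by rewrite mu_circle ltry.
  apply: le_measure; rewrite ?inE//; first exact: measurable_circle.
  move=> x [_]; rewrite /= in_itv /= => /andP[x0 x1].
  by apply/circleP; split; lra.
have e20 : 0 < eps / 2 by lra.
have [K [cK KC KCe]] := lebesgue_regularity_inner mC' Cfin e20.
have [U' [oU' CU' UCe']] := lebesgue_regularity_outer mC' Cfin e20.
pose U := U' `&` `]0, 1[%classic.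
have oU : open U by apply: openI => //; exact: itv_open.
have mU : measurable U by exact: open_measurable.
have CU : C `<=` U by move=> x Cx; split; [exact: CU'|case: Cx].
have UCe : (mu (U `\` C) < (eps / 2)%:E)%E.
  apply: le_lt_trans UCe'; apply: le_measure; rewrite ?inE.
  - exact: measurableD.
  - by apply: measurableD => //; exact: open_measurable.
  - by move=> x [[]].
have mK : measurable K by apply: closed_measurable; exact: compact_closed.
have : \forall s \near (0 : R), K `<=` (fun x => U (x + s)).
  apply: ((compact_near_coveringP K).1 cK _ (nbhs (0 : R)) (fun s x => U (x + s))).
  move=> x Kx.
  have Ux : U (x + 0) by rewrite addr0; apply/CU/KC.
  have : (fun z : R * R => z.1 + z.2) @ (x, 0 : R) --> x + 0.
    by apply: cvgD; [exact: cvg_fst|exact: cvg_snd].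
  by apply; exact: open_nbhs_nbhs.
move=> /nbhs_ballP[eta /= eta0 heta]; exists eta => // s se.
have {}heta : K `<=` (fun x => U (x + s)).
  by apply: heta; rewrite /ball /= sub0r normrN.
have mshift : measurable ((fun x : R => x + s) @^-1` (U `\` C)).
  rewrite -[X in measurable X]setTI.
  apply: (@nondecreasing_measurable _ setT (fun x : R => x + s)) => //.
    by move=> x y xy; rewrite lerD2r.
  exact: measurableD.
have mAs : measurable (A `\` rot s @^-1` A).
  by apply: measurableD => //; exact: measurable_rot_preimage.
rewrite -lte_fin -circle_measureE//.
(* A point of [A] that [rot s] takes out of [A] is 0, or misses [K], or is moved into [U] but not
   into [C]. *)
apply: (@le_lt_trans _ _ (mu ([set 0] `|` (C `\` K) `|`
    (fun x : R => x + s) @^-1` (U `\` C)))).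
  apply: le_measure; rewrite ?inE; first exact: mC.
    by apply: measurableU => //; apply: measurableU => //; exact: measurableD.
  move=> x [cx [Ax nAx]].
  have [->|/eqP x0] := eqVneq x 0; first by left; left.
  have Cx : C x.
    split=> //; rewrite /= in_itv /= lt_neqAle eq_sym.
    by move/circleP: cx => [-> ->]; rewrite !andbT; apply/eqP.
  have [Kx|nKx] := pselect (K x); last by left; right.
  right; have Uxs := heta x Kx; split=> // -[Axs _]; apply: nAx.
  rewrite /= (@rot_eq _ _ _ (x + s) 0) ?addr0//.
  case: Uxs => _; rewrite /= in_itv /= => /andP[xs0 xs1].
  by apply/circleP; split; lra.
apply: (le_lt_trans (measureU2 _ _ _)) => //.
  by apply: measurableU => //; exact: measurableD.
have h2 : (mu ((fun x : R => x + s)%R @^-1` (U `\` C)) < (eps / 2)%:E)%E.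
  by rewrite lebesgue_measure_shift//; exact: measurableD.
have h1 : (mu ([set 0%R] `|` (C `\` K)) < (eps / 2)%:E)%E.
  apply: le_lt_trans KCe; apply: (le_trans (measureU2 _ _ _)) => //.
    exact: measurableD.
  by rewrite [X in (X + _)%E]lebesgue_measure_set1 add0e.
by rewrite [eps]splitr EFinD; exact: lteD.
Qed.

End circle_measure.

(** * Ergodicity of irrational rotations *)

Section ergodicity.
Variable R : realType.
Local Notation mu := (@lebesgue_measure R).
Local Notation lam := (@circle_measure R).
Implicit Types (A C : set R).

Let mrot2 A C : measurable A -> measurable C ->
  measurable [set z : R * R | circle R z.2 /\ C z.2 /\ A (rot z.1 z.2)].
Proof.
move=> mA mC.
have mr : measurable_fun setT (fun z : R * R => rot z.1 z.2).
  rewrite (_ : (fun z => _) = rot 0 \o (fun z : R * R => z.2 + z.1)); last first.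
    by apply/funext => z; rewrite /= rot_addr.
  apply: measurableT_comp; first exact: measurable_rot.
  by apply: measurable_funD.
rewrite (_ : [set z | _] = [set: R] `*` (circle R `&` C) `&`
    (fun z : R * R => rot z.1 z.2) @^-1` A).
  apply: measurableI; last by rewrite -[X in measurable X]setTI; exact: mr.
  by apply: measurableX => //; apply: measurableI => //; exact: measurable_circle.
by apply/seteqP; split=> z /=; tauto.
Qed.

Lemma measurable_circle_correlation A C : measurable A -> measurable C ->
  measurable_fun setT (fun s => (lam (C `&` rot s @^-1` A))%:E).
Proof.
move=> mA mC; have := measurable_fun_xsection mu (mrot2 mA mC).
apply: eq_measurable_fun => s _ /=.
rewrite -circle_measureE; last first.
  by apply: measurableI => //; exact: measurable_rot_preimage.
by congr (mu _); apply/seteqP; split=> x; rewrite /xsection /= in_setE.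
Qed.

(** Tonelli: for fixed [x] in [C], the rotations [s] taking [x] into [A] form a rotated copy of [A],
    of measure [lam A]. *)
Lemma integral_circle_correlation A C : measurable A -> measurable C ->
  (\int[mu]_(s in circle R) (lam (C `&` rot s @^-1` A))%:E = (lam C * lam A)%:E)%E.
Proof.
move=> mA mC; pose W := (circle R `*` [set: R]) `&`
  [set z : R * R | circle R z.2 /\ C z.2 /\ A (rot z.1 z.2)].
have mW : measurable W.
  apply: measurableI; last exact: mrot2.
  by apply: measurableX => //; exact: measurable_circle.
have := indic_fubini_tonelli mu mu mW.
rewrite indic_fubini_tonelli_FE// indic_fubini_tonelli_GE//.
have mCA s : measurable (C `&` rot s @^-1` A).
  by apply: measurableI => //; exact: measurable_rot_preimage.
have -> : (\int[mu]_s (mu \o xsection W) s =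
    \int[mu]_(s in circle R) (lam (C `&` rot s @^-1` A))%:E)%E.
  rewrite [RHS]integral_mkcond; apply: eq_integral => s _.
  rewrite /patch /=; case: ifPn => [|ns].
    rewrite inE => cs; rewrite -circle_measureE//.
    congr (mu _); apply/seteqP; split=> x; rewrite /xsection /= in_setE /W /=; tauto.
  rewrite (_ : xsection W s = set0) ?measure0//.
  apply/seteqP; split=> x //; rewrite /xsection /= in_setE /W /= => -[[cs _] _].
  by rewrite notin_setE in ns.
have mcC : measurable (circle R `&` C).
  by apply: measurableI => //; exact: measurable_circle.
have -> : (\int[mu]_x (mu \o ysection W) x =
    \int[mu]_(x in circle R `&` C) (lam A)%:E)%E.
  rewrite [RHS]integral_mkcond; apply: eq_integral => x _.
  rewrite /patch /=; case: ifPn => [|nx].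
    rewrite inE => -[cx Cx]; rewrite -(circle_measure_rot x)//.
    rewrite -circle_measureE; last exact: measurable_rot_preimage.
    congr (mu _); apply/seteqP; split=> s;
    by rewrite /ysection /= in_setE /W /= /rot (addrC s x); tauto.
  rewrite (_ : ysection W x = set0) ?measure0//.
  apply/seteqP; split=> s //; rewrite /ysection /= in_setE /W /= => -[_ [cx [Cx _]]].
  by rewrite notin_setE in nx; apply: nx.
by rewrite integral_cst//= circle_measureE// => ->; rewrite -EFinM mulrC.
Qed.

Variable alpha : R.
Hypotheses (halpha : circle R alpha) (alpha_irr : irrational alpha).

(** The multiples of a nonzero [d = q alpha - p] shorter than [eta] form a ladder whose rungs pass
    within [eta] of every target on its side. *)
Lemma rotz_dense (s eta : R) : 0 < eta -> exists (j : nat) (m : int),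
  `|j%:R * alpha - m%:~R - s| < eta.
Proof.
move=> eta0.
have [q [p [_ [_ [_ _ _ /andP[]]]]]] := odd_approximation halpha alpha_irr eta0.
set d := _ - _ => d0 deta.
have near_mult (r : R) : 0 <= r -> exists k : nat, `|k%:R * `|d| - r| < eta.
  move=> r0; exists (Num.trunc (r / `|d|)).
  have /trunc_itv/andP[t1 t2] : 0 <= r / `|d| by rewrite divr_ge0.
  rewrite ler_pdivlMr// in t1; rewrite ltr_pdivrMr// -natr1 in t2.
  by rewrite ler0_norm; lra.
have /andP[f0 f1] := floor_itv s; rewrite intrD in f1.
(* The ladder climbs to [s] from the integer below it, or descends to [s] from the integer above
   it. *)
have [dp|dn] := leP 0 d.
  have [|k hk] := near_mult (s - (Num.floor s)%:~R); first lra.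
  exists (k * q)%N, (k%:Z * p - Num.floor s).
  rewrite (ger0_norm dp) in hk.
  rewrite (_ : _ - s = k%:R * d - (s - (Num.floor s)%:~R))//.
  by rewrite /d; ring.
have [|k hk] := near_mult ((Num.floor s)%:~R + 1 - s); first lra.
exists (k * q)%N, (k%:Z * p - Num.floor s - 1).
rewrite (ltr0_norm dn) -normrN in hk.
rewrite (_ : _ - s = - (k%:R * - d - ((Num.floor s)%:~R + 1 - s)))//.
by rewrite /d; ring.
Qed.

(** The correlation of [C] with the rotated [A] vanishes along a dense orbit, hence for every [s] by
    continuity of rotation in measure; its integral over [s] is the product. *)
Lemma rotz_ergodic A C : measurable A -> measurable C ->
  (forall j : nat, lam (C `&` rotz alpha j @^-1` A) = 0) -> lam C * lam A = 0.
Proof.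
move=> mA mC CA0.
have mrA s : measurable (rot s @^-1` A) by exact: measurable_rot_preimage.
suff CA s : lam (C `&` rot s @^-1` A) = 0.
  apply: EFin_inj; rewrite -integral_circle_correlation//.
  by under eq_integral do rewrite CA; rewrite integral0.
apply/eqP; rewrite eq_le circle_measure_ge0 andbT; apply/ler_addgt0Pr => eps eps0.
rewrite add0r.
have [eta eta0 small] := circle_measure_rotD mA eps0.
have [j [m jm]] := rotz_dense s eta0.
set d := _ - s in jm.
have jE x : rotz alpha j x = rot d (rot s x).
  rewrite rotD /rotz -(rotDint _ (- m)); congr rot.
  by rewrite /d rmorphN; ring.
apply: (@le_trans _ _ (lam ((C `&` rotz alpha j @^-1` A) `|`
    rot s @^-1` (A `\` rot d @^-1` A)))).
  have mD : measurable (A `\` rot d @^-1` A) by exact: measurableD.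
  apply: circle_measure_le; first exact: measurableI.
    apply: measurableU; last exact: measurable_rot_preimage.
    by apply: measurableI => //; exact: mrA.
  move=> x _ [Cx Ax]; rewrite /preimage /= jE.
  by have [dA|dA] := pselect (A (rot d (rot s x))); [left|right].
apply: (le_trans (circle_measureU _ _)).
- by apply: measurableI => //; exact: mrA.
- by apply: measurable_rot_preimage; exact: measurableD.
rewrite CA0 add0r circle_measure_rot; last exact: measurableD.
exact/ltW/small.
Qed.

(** The set missed by all the preimages is null by [rotz_ergodic]; continuity from above then leaves
    finitely many of them. *)
Lemma rotz_sweep A eps : measurable A -> 0 < lam A -> 0 < eps ->
  exists N : nat, lam (~` \big[setU/set0]_(j < N) (rotz alpha j @^-1` A)) < eps.
Proof.
move=> mA A0 eps0.
have mF (j : nat) : measurable (rotz alpha j @^-1` A).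
  exact: measurable_rot_preimage.
pose F N := circle R `&` ~` \big[setU/set0]_(j < N) (rotz alpha j @^-1` A).
have mU N : measurable (\big[setU/set0]_(j < N) (rotz alpha j @^-1` A)).
  by apply: bigsetU_measurable => j _; exact: mF.
have mFN N : measurable (F N).
  by apply: measurableI; [exact: measurable_circle|exact: measurableC].
have UE N : \big[setU/set0]_(j < N) (rotz alpha j @^-1` A) =
    \bigcup_(j in `I_N) (rotz alpha j @^-1` A).
  by rewrite (bigcup_mkord N (fun j : nat => rotz alpha j @^-1` A)).
pose C := ~` \bigcup_(j in [set: nat]) (rotz alpha j @^-1` A).
have mC : measurable C by apply: measurableC; exact: bigcupT_measurable.
have C0 : lam C = 0.
  have /eqP : lam C * lam A = 0.
    apply: rotz_ergodic => // j.
    rewrite (_ : _ `&` _ = set0) /circle_measure ?setI0 ?measure0//.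
    by apply/seteqP; split=> x // -[Cx Ax]; apply: Cx; exists j.
  by rewrite mulf_eq0 (gt_eqF A0) orbF => /eqP.
have capF : \bigcap_N F N = circle R `&` C.
  apply/seteqP; split=> x.
    move=> Fx; split; first by have [] := Fx 0%N I.
    move=> [j _ jx]; have [_] := Fx j.+1 I; apply.
    by rewrite big_ord_recr /=; right.
  move=> [cx nC] N _; split=> // UN; apply: nC.
  by move: UN; rewrite UE => -[j _ jx]; exists j.
have : mu \o F @ \oo --> mu (\bigcap_N F N).
  apply: nonincreasing_cvg_mu => //.
  - by rewrite [X in (X < _)%E]circle_measureE ?ltry//; exact: measurableC.
  - by rewrite capF; apply: measurableI => //; exact: measurable_circle.
  - move=> m n mn; apply/subsetPset => x [cx nU]; split=> // mU'; apply: nU.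
    move: mU'; rewrite !UE => -[j jm jx]; exists j => //=.
    exact: leq_trans mn.
rewrite capF [X in _ --> X]circle_measureE// C0 => /fine_cvgP[_].
move=> /cvgr0Pnorm_lt /(_ _ eps0)[N _ /(_ N (leqnn N))].
move=> /= h; exists N; apply: le_lt_trans h; exact: ler_norm.
Qed.

End ergodicity.

(** * Almost invariant level sets and essential values *)

Section essential_value_criterion.
Variables (R : realType) (alpha : R).
Hypotheses (halpha : circle R alpha) (alpha_irr : irrational alpha).
Local Notation mu := (@lebesgue_measure R).
Local Notation lam := (@circle_measure R).

(** A point that is outside [D] after [j] steps left it at some single step, and all steps lose the
    same measure by invariance. *)
Lemma circle_measure_rotzD (D : set R) (j : nat) : measurable D ->
  lam (D `\` rotz alpha j @^-1` D) <= j%:R * lam (D `\` rotz alpha 1 @^-1` D).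
Proof.
move=> mD; have mDr n : measurable (D `\` rotz alpha n @^-1` D).
  by apply: measurableD => //; exact: measurable_rot_preimage.
elim: j => [|j IH].
  rewrite mul0r (_ : lam _ = lam set0).
    by rewrite /circle_measure setI0 measure0.
  by apply: eq_circle_measure => x cx; split=> // -[Dx]; rewrite /= rotz0.
apply: (@le_trans _ _ (lam ((D `\` rotz alpha j @^-1` D) `|`
    rotz alpha j @^-1` (D `\` rotz alpha 1 @^-1` D)))).
  apply: circle_measure_le => //.
    by apply: measurableU => //; exact: measurable_rot_preimage.
  move=> x _ [Dx nD]; have [Dj|nDj] := pselect (D (rotz alpha j x)); [right|by left].
  by split=> //= D1; apply: nD; rewrite /= intS addrC -rotzD.
apply: (le_trans (circle_measureU _ _)) => //; first exact: measurable_rot_preimage.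
by rewrite circle_measure_rot// -natr1 mulrDl mul1r lerD2r.
Qed.

Lemma measurable_cocycle_a_level (n : int) (k : int) :
  measurable [set x | cocycle_a alpha n x = k].
Proof.
rewrite (_ : [set x | _] =
  (fun x => (cocycle_a alpha n x)%:~R : R) @^-1` [set k%:~R]).
  by rewrite -[X in measurable X]setTI; exact: measurable_cocycle_a.
by apply/seteqP; split=> x /=; [move=> ->|move/intr_inj].
Qed.

Lemma rotz_near (q : nat) (p : int) x :
  rotz alpha q x = rot (q%:R * alpha - p%:~R) x.
Proof. by rewrite -[RHS](rotDint _ p) subrK. Qed.

(** One rotation changes a_q by f (x + q alpha) - f x, which vanishes unless the short rotation by q
    alpha - p carries [x] across a jump of f. The bound depends on that length alone, so it is
    uniform in [q] and [k]. *)
Lemma cocycle_a_almost_invariant eps : 0 < eps -> exists2 eta, 0 < eta &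
  forall (q : nat) (p k : int), `|q%:R * alpha - p%:~R| < eta ->
  lam ([set x | cocycle_a alpha q x = k] `\`
       rotz alpha 1 @^-1` [set x | cocycle_a alpha q x = k]) < eps.
Proof.
move=> eps0; have e20 : 0 < eps / 2 by lra.
pose J : set R := [set x | x < 1 / 2].
have mJ : measurable J.
  rewrite (_ : J = `]-oo, (1 / 2)[%classic); first exact: measurable_itv.
  by apply/seteqP; split=> x; rewrite /= in_itv.
have mJC : measurable (~` J) by exact: measurableC.
have [eta1 eta10 h1] := circle_measure_rotD mJ e20.
have [eta2 eta20 h2] := circle_measure_rotD mJC e20.
exists (Num.min eta1 eta2); first by rewrite lt_min eta10.
move=> q p k; rewrite lt_min => /andP[q1 q2]; set D := [set x | _].
set s := _ - _ in q1 q2.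
have mr s' B : measurable B -> measurable (rot s' @^-1` B :> set R).
  exact: measurable_rot_preimage.
have mD : measurable D by exact: measurable_cocycle_a_level.
apply: (@le_lt_trans _ _ (lam ((J `\` rot s @^-1` J) `|`
    (~` J `\` rot s @^-1` (~` J))))).
  apply: circle_measure_le.
  - by apply: measurableD => //; exact: mr.
  - by apply: measurableU; apply: measurableD => //; exact: mr.
  move=> x cx [Dx nD]; apply: contrapT => nJ; apply: nD.
  have stepE : step (rotz alpha q x) = step x.
    rewrite (rotz_near q p) /step -/s.
    have [Jx|Jx] := boolP (x < 1 / 2); case: ifPn => // Jsx; exfalso; apply: nJ.
      by left; split=> //= Js; move: Jsx; rewrite Js.
    by right; split; [exact/negP|rewrite /preimage /= => nJs; exact: nJs].
  (* Expanding the cocycle at time q + 1 in both orders gives the change of a_q under one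
     rotation. *)
  have e1 := cocycle_aS alpha q cx.
  have e2 := cocycle_aD alpha 1 q cx.
  rewrite addrC e1 stepE in e2.
  rewrite /D /= -[RHS]Dx; apply: (addrI (cocycle_a alpha 1 x)); rewrite -e2 addrC.
  by congr (_ + _); rewrite /= /step_sum big_ord1 rotz0.
apply: (le_lt_trans (circle_measureU _ _)).
- by apply: measurableD => //; exact: mr.
- by apply: measurableD => //; exact: mr.
by have := h1 s q1; have := h2 s q2; lra.
Qed.

Lemma cocycle_at_level (t : R) (n k1 k2 : int) :
  [set x | cocycle_at alpha t n x = (k1, k2)] =
  [set x | cocycle_a alpha n x = k1] `&`
  rot t @^-1` [set x | cocycle_a alpha n x = k2].
Proof.
by apply/seteqP; split=> x; rewrite /cocycle_at /= => -[-> ->].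
Qed.

(* N translates of A cover the circle up to c / 2.  As D is almost invariant, each
   of them meets D in about lam (D `&` A), so the latter is at least about
   c / (2 N), while A is almost invariant under rotz alpha q. *)
Lemma E2_criterion (t : R) (k1 k2 : int) c : 0 < c ->
  (forall eta, 0 < eta -> exists (q : nat) (p : int),
     `|q%:R * alpha - p%:~R| < eta /\
     c <= lam [set x | cocycle_at alpha t q x = (k1, k2)]) ->
  E2 alpha t (k1, k2).
Proof.
move=> c0 hq A mA Ac A0.
have lA0 : 0 < lam A by rewrite -circle_measure_gt0// setIidr.
have c20 : 0 < c / 2 by lra.
have [N sweep] := rotz_sweep halpha alpha_irr mA lA0 c20.
have N0 : 0 <= N%:R :> R by [].
(* Chosen to make [eN] hold; the final + 1 keeps the denominator positive when [N] is 0. *)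
pose e : R := c / 2 / (N%:R * (1 + 2 * N%:R) + 1).
have den0 : 0 < N%:R * (1 + 2 * N%:R) + 1 :> R by rewrite ltr_wpDl// mulr_ge0//; lra.
have e0 : 0 < e by rewrite divr_gt0.
have eN : N%:R * (e + N%:R * (2 * e)) < c / 2.
  have : e * (N%:R * (1 + 2 * N%:R) + 1) = c / 2 by rewrite divfK// gt_eqF.
  lra.
have [eta1 eta10 h1] := cocycle_a_almost_invariant e0.
have [eta2 eta20 h2] := circle_measure_rotD mA e0.
have [|q [p [qp cD]]] := hq (Num.min eta1 eta2); first by rewrite lt_min eta10.
move: qp; rewrite lt_min => /andP[q1 q2].
set D := [set x | _] in cD.
have mD : measurable D by exact: measurable_cocycle_at.
have mr (n : int) B : measurable B -> measurable (rotz alpha n @^-1` B :> set R).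
  exact: measurable_rot_preimage.
have mret n : measurable (A `&` rotz alpha n @^-1` A `&`
    [set x | [set (k1, k2)] (cocycle_at alpha t n x)]).
  apply: measurableI; last exact: measurable_cocycle_at.
  by apply: measurableI => //; exact: mr.
apply/(bigcup_int_gt0 mret); exists q.
rewrite -[X in mu X](setIidr (A := circle R)); last by move=> x [[/Ac]].
rewrite circle_measure_gt0//.
set L := lam _.
rewrite ltNge; apply/negP => L0.
have D1 : lam (D `\` rotz alpha 1 @^-1` D) <= 2 * e.
  rewrite /D cocycle_at_level.
  set E1 := [set x | cocycle_a alpha q x = k1].
  set E2 := [set x | cocycle_a alpha q x = k2].
  have mE1 : measurable E1 by exact: measurable_cocycle_a_level.
  have mE2 : measurable E2 by exact: measurable_cocycle_a_level.
  have mtE2 : measurable (rot t @^-1` E2) by exact: measurable_rot_preimage.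
  apply: (@le_trans _ _ (lam ((E1 `\` rotz alpha 1 @^-1` E1) `|`
      rot t @^-1` (E2 `\` rotz alpha 1 @^-1` E2)))).
    apply: circle_measure_le.
    - apply: measurableD; first exact: measurableI.
      by apply: mr; exact: measurableI.
    - apply: measurableU; first by apply: measurableD => //; exact: mr.
      by apply: measurable_rot_preimage; apply: measurableD => //; exact: mr.
    move=> x _ [[x1 x2] nx].
    have [y1|y1] := pselect (E1 (rotz alpha 1 x)); last by left.
    right; split=> // y2; apply: nx; split=> //.
    by rewrite /= rot_rotz.
  apply: (le_trans (circle_measureU _ _)).
  - by apply: measurableD => //; exact: mr.
  - by apply: measurable_rot_preimage; apply: measurableD => //; exact: mr.
  rewrite circle_measure_rot; last by apply: measurableD => //; exact: mr.
  by have := h1 q p k1 q1; have := h1 q p k2 q1; rewrite /= -/E1 -/E2; lra.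
(* A point of [D] and [A] either returns to [A] at time [q], in a set assumed null, or is among the
   few that leave [A]. *)
have DA : lam (D `&` A) <= e.
  apply: (@le_trans _ _ (lam ((A `&` rotz alpha q @^-1` A `&` D) `|`
      (A `\` rotz alpha q @^-1` A)))).
    apply: circle_measure_le; first exact: measurableI.
      by apply: measurableU; [exact: mret|apply: measurableD => //; exact: mr].
    move=> x _ [Dx Ax].
    by have [rA|rA] := pselect (A (rotz alpha q x)); [left|right].
  apply: (le_trans (circle_measureU _ _)); first exact: mret.
    by apply: measurableD => //; exact: mr.
  have : lam (A `\` rotz alpha q @^-1` A) < e.
    by rewrite (_ : rotz alpha q = rot (q%:R * alpha - p%:~R)) ?h2//;
      apply/funext => x; exact: rotz_near.
  by move: L0; rewrite /L; lra.
have DjA (j : nat) : (j < N)%N ->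
    lam (D `&` rotz alpha j @^-1` A) <= e + N%:R * (2 * e).
  move=> jN.
  apply: (@le_trans _ _ (lam (rotz alpha j @^-1` (D `&` A) `|`
      (D `\` rotz alpha j @^-1` D)))).
    apply: circle_measure_le.
    - by apply: measurableI => //; exact: mr.
    - apply: measurableU; first by apply: mr; exact: measurableI.
      by apply: measurableD => //; exact: mr.
    move=> x _ [Dx Ax].
    by have [rD|rD] := pselect (D (rotz alpha j x)); [left|right].
  apply: (le_trans (circle_measureU _ _)).
  - by apply: mr; exact: measurableI.
  - by apply: measurableD => //; exact: mr.
  rewrite circle_measure_rot; last exact: measurableI.
  apply: lerD => //; apply: (le_trans (circle_measure_rotzD j mD)).
  apply: ler_pM => //; first exact: circle_measure_ge0.
  by rewrite ler_nat ltnW.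
have DU (M : nat) : (M <= N)%N ->
    lam (D `&` \big[setU/set0]_(j < M) (rotz alpha j @^-1` A)) <=
    M%:R * (e + N%:R * (2 * e)).
  elim: M => [_|M IH MN].
    by rewrite big_ord0 setI0 mul0r /circle_measure setI0 measure0.
  rewrite big_ord_recr /= setIUr -natr1 mulrDl mul1r.
  apply: (le_trans (circle_measureU _ _)).
  - apply: measurableI => //; apply: bigsetU_measurable => j _; exact: mr.
  - by apply: measurableI => //; exact: mr.
  by apply: lerD; [apply: IH; exact: ltnW|exact: DjA].
have mU : measurable (\big[setU/set0]_(j < N) (rotz alpha j @^-1` A)).
  by apply: bigsetU_measurable => j _; exact: mr.
(* The part of [D] in the swept region and the part outside it are each below c / 2, against
   [cD]. *)
have := DU N (leqnn N).
have := circle_measureID mD mU.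
have : lam (D `\` \big[setU/set0]_(j < N) (rotz alpha j @^-1` A)) <=
    lam (~` \big[setU/set0]_(j < N) (rotz alpha j @^-1` A)).
  apply: circle_measure_le; [exact: measurableD|exact: measurableC|].
  by move=> x _ [].
move: cD sweep eN; rewrite -/D; lra.
Qed.

End essential_value_criterion.

(** * Almost every translation *)

Section almost_every_translation.
Variables (R : realType) (alpha : R).
Hypotheses (halpha : circle R alpha) (alpha_irr : irrational alpha).
Local Notation mu := (@lebesgue_measure R).
Local Notation lam := (@circle_measure R).

Lemma rot_half_step x : circle R x -> step (rot (1 / 2) x) = - step x.
Proof.
move=> cx; have /circleP[x0 x1] := cx; have [xh|xh] := ltP x (1 / 2).
  rewrite (@rot_eq _ _ _ (x + 1 / 2) 0) ?addr0//; last by apply/circleP; split; lra.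
  by rewrite /step xh ifN// -leNgt; lra.
rewrite (@rot_eq _ _ _ (x - 1 / 2) 1); first last.
- by lra.
- by apply/circleP; split; lra.
by rewrite /step ifT ?ifN ?opprK -?leNgt//; lra.
Qed.

Lemma step_sum_rot_half (q : nat) x :
  step_sum alpha q (rot (1 / 2) x) = - step_sum alpha q x.
Proof.
rewrite /step_sum -sumrN; apply: eq_bigr => i _.
by rewrite -rot_rotz rot_half_step//; exact: rot_circle.
Qed.

(** The half turn exchanges the levels 1 and -1, which fill the circle by [step_sum_odd]. *)
Lemma circle_measure_odd_level (q : nat) (p u v k : int) : odd q ->
  u * p + v * q = 1 -> q%:R * `|q%:R * alpha - p%:~R| <= 1 / 2 ->
  k = 1 \/ k = -1 -> lam [set x | cocycle_a alpha q x = k] = 1 / 2.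
Proof.
move=> oq uv qp.
have mL := measurable_cocycle_a_level alpha q.
have sym : lam [set x | cocycle_a alpha q x = -1] =
    lam [set x | cocycle_a alpha q x = 1].
  rewrite -(circle_measure_rot (1 / 2))//; apply: eq_circle_measure => x _ /=.
  by rewrite step_sum_rot_half; split=> [|->//] /eqP; rewrite eqr_opp => /eqP.
have := circle_measureID measurableT (mL 1).
rewrite circle_measureT setTI (_ : [set: R] `\` _ =
    [set x | cocycle_a alpha q x = -1]).
  by rewrite sym => h [->|->]; rewrite ?sym; lra.
apply/seteqP; split=> x /=; last by move=> ->.
have q0 : (0 < q)%N by case: (q) oq.
by have [->|->] := step_sum_odd q0 x oq uv qp => -[].
Qed.

Lemma E2_ae (k1 k2 : int) : k1 = 1 \/ k1 = -1 -> k2 = 1 \/ k2 = -1 ->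
  {ae mu, forall t, circle R t -> E2 alpha t (k1, k2)}.
Proof.
move=> k1E k2E.
have /choice[q hq] (n : nat) : exists q : nat, exists p : int,
    [/\ `|q%:R * alpha - p%:~R| < n.+1%:R^-1,
     lam [set x | cocycle_a alpha q x = k1] = 1 / 2 &
     lam [set x | cocycle_a alpha q x = k2] = 1 / 2].
  have [//|q [p [u [v [oq uv qp /andP[_ pn]]]]]] :=
    odd_approximation halpha alpha_irr (_ : 0 < n.+1%:R^-1).
  by exists q, p; split=> //; apply: circle_measure_odd_level oq uv qp _.
have {hq}/choice[p hq] := hq.
have near eta : 0 < eta -> exists N, forall n, (N <= n)%N ->
    `|(q n)%:R * alpha - (p n)%:~R| < eta.
  move=> eta0; exists (Num.trunc eta^-1) => n nN; have [qn _ _] := hq n.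
  apply: lt_trans qn _; rewrite invf_plt ?posrE//.
  apply: lt_le_trans (truncnS_gt _) _; by rewrite ler_nat.
pose D1 n := [set x | cocycle_a alpha (q n) x = k1].
pose D2 n := [set x | cocycle_a alpha (q n) x = k2].
have mD1 n : measurable (D1 n) by exact: measurable_cocycle_a_level.
have mD2 n : measurable (D2 n) by exact: measurable_cocycle_a_level.
pose m n t := lam (D1 n `&` rot t @^-1` D2 n).
(* The convergence of [m n t] to 0 in countable form, which makes [Z] measurable. *)
pose Z := \bigcap_k \bigcup_N \bigcap_(n in [set n | (N <= n)%N])
  [set t | m n t <= k.+1%:R^-1].
have ZP t : Z t <-> forall e, 0 < e -> exists N, forall n, (N <= n)%N -> m n t <= e.
  split=> [Zt e e0|Zt k _].
    have [N _ hN] := Zt (Num.trunc e^-1) I.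
    exists N => n nN; apply: le_trans (hN n nN) _.
    rewrite invf_ple ?posrE//; exact/ltW/truncnS_gt.
  have [|N hN] := Zt k.+1%:R^-1; first by rewrite invr_gt0.
  by exists N => // n /hN.
have mm n : measurable_fun setT (fun t => (m n t)%:E).
  exact: measurable_circle_correlation.
have mZ : measurable Z.
  apply: bigcapT_measurable => k; apply: bigcupT_measurable => N.
  apply: bigcap_measurable => [|n _]; first by exists N => /=.
  rewrite (_ : [set t | _] = m n @^-1` `]-oo, k.+1%:R^-1]%classic).
    rewrite -[X in measurable X]setTI.
    by have /measurable_EFinP mmn := mm n; apply: mmn => //; exact: measurable_itv.
  by apply/seteqP; split=> t /=; rewrite in_itv.
(* [D2 n] is asymptotically invariant, so moving [t] along its orbit hardly changes [m n t]. Hence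
   no preimage of [Z] meets its complement, as [rotz_ergodic] requires. *)
have Zinv (j : nat) t : Z (rotz alpha j t) -> Z t.
  move=> /ZP Zj; apply/ZP => e e0.
  have [N1 hN1] := Zj _ (divr_gt0 e0 (ltr0Sn R 1)).
  (* The [j] steps lose at most half of [e] in total; [j.+1] avoids dividing by zero. *)
  have dj0 : 0 < e / 2 / j.+1%:R by rewrite !divr_gt0.
  have [eta eta0 heta] := cocycle_a_almost_invariant alpha dj0.
  have [N2 hN2] := near _ eta0.
  exists (maxn N1 N2) => n; rewrite geq_max => /andP[n1 n2].
  have mr s B : measurable B -> measurable (rot s @^-1` B :> set R).
    exact: measurable_rot_preimage.
  have mDj : measurable (D2 n `\` rotz alpha j @^-1` D2 n).
    by apply: measurableD => //; exact: mr.
  apply: (@le_trans _ _ (lam ((D1 n `&` rot (rotz alpha j t) @^-1` D2 n) `|`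
      rot t @^-1` (D2 n `\` rotz alpha j @^-1` D2 n)))).
    apply: circle_measure_le.
    - by apply: measurableI => //; exact: mr.
    - by apply: measurableU; [apply: measurableI => //; exact: mr|exact: mr].
    move=> x _ [x1 x2].
    have [y|y] := pselect (D2 n (rotz alpha j (rot t x))); [left|by right].
    split=> //; suff e' : rotz alpha j (rot t x) = rot (rotz alpha j t) x.
      by rewrite e' in y.
    rewrite /rotz rotD -[LHS](rotDint _ (- Num.floor (t + j%:~R * alpha))).
    by rewrite rmorphN.
  apply: (le_trans (circle_measureU _ _)).
  - by apply: measurableI => //; exact: mr.
  - exact: mr.
  rewrite circle_measure_rot//.
  have h1 := hN1 n n1; rewrite /m in h1.
  have h2 := circle_measure_rotzD alpha j (mD2 n).
  have h3 := ltW (heta (q n) (p n) k2 (hN2 n n2)); rewrite -/(D2 n) in h3.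
  have h4 : j.+1%:R * lam (D2 n `\` rotz alpha 1 @^-1` D2 n) <= e / 2.
    by rewrite mulrC -ler_pdivlMr.
  have h5 := circle_measure_ge0 (D2 n `\` rotz alpha 1 @^-1` D2 n).
  by rewrite -natr1 in h4; lra.
have Z0 : lam Z = 0.
  have mZC : measurable (~` Z) by exact: measurableC.
  have /eqP : lam (~` Z) * lam Z = 0.
    apply: (rotz_ergodic halpha alpha_irr) => // j.
    rewrite (_ : _ `&` _ = set0) /circle_measure ?setI0 ?measure0//.
    by apply/seteqP; split=> x // -[nZ] /Zinv.
  (* If the complement of [Z] were null, dominated convergence would force the integrals of [m n],
     all equal to 1/4, to tend to 0. *)
  rewrite mulf_eq0 => /orP[/eqP ZC0|/eqP//]; exfalso.
  have mc := @measurable_circle R.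
  have Zae : {ae mu, forall t, circle R t -> (fun n => (m n t)%:E) @ \oo --> 0%E}.
    exists (circle R `&` ~` Z); split; first exact: measurableI.
      by rewrite [LHS]circle_measureE// ZC0.
    move=> t /= nt; split; first by apply: contrapT => h; apply: nt => /h.
    move=> /ZP Zt; apply: nt => _.
    apply: cvg_EFin; first exact: nearW.
    apply/cvgr0Pnorm_le => e e0; have [N hN] := Zt e e0.
    by exists N => // n /= /hN; rewrite ger0_norm// circle_measure_ge0.
  have int1 : mu.-integrable (circle R) (EFin \o cst (1 : R)).
    apply: measurable_bounded_integrable => //.
      by rewrite -[circle R]setIT [X in (X < _)%E]circle_measureE// ltry.
    by exists 1; split=> // M M1 x _; rewrite /= normr1 ltW.
  have bound : {ae mu, forall t n,
      circle R t -> (`|(m n t)%:E| <= (EFin \o cst (1%R : R)) t)%E}.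
    apply: aeW => t n _; rewrite /= lee_fin ger0_norm ?circle_measure_ge0//.
    apply: circle_measure_le1; apply: measurableI => //.
    exact: measurable_rot_preimage.
  have [_ _] := @dominated_convergence _ _ _ mu _ mc
    (fun n t => (m n t)%:E) (cst 0%E) _ (fun n => measurable_funTS (mm n)) 
    (measurable_cst _) Zae int1 bound.
  rewrite (_ : [sequence _]_n = cst (1 / 2 * (1 / 2))%:E); last first.
    apply/funext => n /=; rewrite integral_circle_correlation//.
    by have [_ -> ->] := hq n.
  rewrite integral_cst//= mul0e => /(cvg_lim (@ereal_hausdorff R)).
  by rewrite (cvg_lim (@ereal_hausdorff R) (cvg_cst _)) => -[]; lra.
exists (circle R `&` Z); split.
- by apply: measurableI => //; exact: measurable_circle.
- by rewrite [LHS]circle_measureE// Z0.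
move=> t /= nt; have ct : circle R t by apply: contrapT => h; apply: nt => /h.
split=> //; apply: contrapT => nZ; apply: nt => _.
(* Outside [Z] the measures stay above some [c] infinitely often, as [E2_criterion] asks. *)
have [c c0 hc] : exists2 c, 0 < c & forall N, exists2 n, (N <= n)%N & c <= m n t.
  apply: contrapT => h; apply: nZ; apply/ZP => e e0; apply: contrapT => h'.
  apply: h; exists e => // N; apply: contrapT => h''; apply: h'; exists N => n nN.
  by rewrite leNgt; apply/negP => en; apply: h''; exists n => //; exact: ltW.
apply: (E2_criterion halpha alpha_irr c0) => eta /near[N hN].
have [n nN cn] := hc N; exists (q n), (p n); split; first exact: hN.
by rewrite cocycle_at_level.
Qed.

End almost_every_translation.

(** * The group of essential values *)

Section essential_value_group.
Variables (R : realType) (alpha : R).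
Local Notation mu := (@lebesgue_measure R).

Lemma step_sum_parity (n : nat) x : (2 %| step_sum alpha n x - n%:Z)%Z.
Proof.
have -> : step_sum alpha n x - n%:Z = \sum_(i < n) (step (rotz alpha i x) - 1).
  by rewrite sumrB sumr_const card_ord natz.
by apply: rpred_sum => i _; rewrite /step; case: ifP.
Qed.

Lemma cocycle_a_parity (n : int) x : (2 %| cocycle_a alpha n x - n)%Z.
Proof.
case: n => n; first exact: step_sum_parity.
rewrite [cocycle_a _ _ _]/= NegzE -opprD -NegzE rpredN.
exact: step_sum_parity.
Qed.

(** Both coordinates have the parity of the time [n]. *)
Lemma cocycle_at_parity t n x :
  ((cocycle_at alpha t n x).1 = (cocycle_at alpha t n x).2 %[mod 2])%Z.
Proof.
apply/eqP; rewrite eqz_mod_dvd /=.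
rewrite -(subrKA n) -[n - _]opprB rpredB//; exact: cocycle_a_parity.
Qed.

(** Test the return condition on the whole circle. A general [P] covers finite essential values and
    the point at infinity together. *)
Lemma essential_value_attained (H : zmodType) (c : int -> R -> H) (P : set H) :
  returns_in alpha c P -> exists n x, P (c n x).
Proof.
move=> /(_ (circle R) (@measurable_circle R) (@subset_refl _ _)) h.
apply: contrapT => nP; have := h _.
rewrite -[X in (0 < mu X)%E](setIT (circle R)) circle_measure_gt0// circle_measureT.
move=> /(_ ltr01); rewrite (_ : \bigcup_(n in _) _ = set0) ?measure0 ?ltxx//.
apply/seteqP; split=> x // -[n _ [_ Px]]; by apply: nP; exists n, x.
Qed.

Lemma E2_eq t : E2 alpha t (1, 1) -> E2 alpha t (1, -1) ->
  E2 alpha t = [set s : int * int | (s.1 = s.2 %[mod 2])%Z].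
Proof.
move=> e1 e2; apply/seteqP; split=> [s /essential_value_attained|[s1 s2] /= /eqP].
  by move=> [n [x <-]]; exact: cocycle_at_parity.
rewrite eqz_mod_dvd => /dvdzP[k kE].
suff : (s1, s2) \in E2_pred alpha t by rewrite /E2_pred inE.
(* Here s1 - s2 = 2 k. *)
rewrite (_ : (s1, s2) = (1, 1) *~ (s1 - k) + (1, -1) *~ k).
  by apply: rpredD; apply: rpredMz; rewrite /E2_pred inE.
have pairMz (a b m : int) : (a, b) *~ m = (a * m, b * m).
  apply: injective_projections => /=.
    by rewrite (raddfMz (@fst int int)) mulrzz.
  by rewrite (raddfMz (@snd int int)) mulrzz.
by rewrite !pairMz; apply: injective_projections => /=; lia.
Qed.

(** By parity the quotient cocycle is identically 0: a nonzero value is never attained, infinity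
    fails for the finite set {0}, and time 0 already returns all of [A] with value 0. *)
Lemma E2_regular t : E2 alpha t = [set s : int * int | (s.1 = s.2 %[mod 2])%Z] ->
  regular alpha t.
Proof.
move=> E2E.
have c0 n x : quotient_cocycle alpha t n x = 0.
  have : cocycle_at alpha t n x - 0 \in E2_pred alpha t.
    by rewrite subr0 /E2_pred inE E2E; exact: cocycle_at_parity.
  rewrite Quotient.idealrBE => /eqP e.
  by rewrite /quotient_cocycle e; exact: raddf0.
rewrite /regular; apply/seteqP; split=> [[h|] /=|_ ->] /=.
- by move=> /essential_value_attained[n [x <-]]; rewrite c0.
- move=> /(_ [set 0] (finite_set1 _))/essential_value_attained[n [x]].
  by rewrite /= c0.
move=> A mA Ac A0; apply: lt_le_trans A0 _; apply: le_measure; rewrite ?inE//.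
  apply: countable_bigcupT_measurable => [|n]; first exact: countableP.
  rewrite (_ : [set x | _] = setT); last by apply/seteqP; split=> x //= _; exact: c0.
  by rewrite setIT; apply: measurableI => //; exact: measurable_rot_preimage.
move=> x Ax; exists 0 => //; split; last exact: c0.
by split=> //=; rewrite rotz0//; exact: Ac.
Qed.

End essential_value_group.

Theorem theorem1 (R : realType) (alpha : R)
    (halpha : circle R alpha) (alpha_irr : irrational alpha) :
  {ae (@lebesgue_measure R), forall t : R, circle R t ->
     E2 alpha t = [set s : int * int | (s.1 = s.2 %[mod 2])%Z]}
  /\
  {ae (@lebesgue_measure R), forall t : R, circle R t -> regular alpha t}.
Proof.
have E2E : {ae (@lebesgue_measure R), forall t : R, circle R t ->
    E2 alpha t = [set s : int * int | (s.1 = s.2 %[mod 2])%Z]}.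
  have h1 := E2_ae halpha alpha_irr (or_introl erefl) (or_introl erefl).
  have h2 := E2_ae halpha alpha_irr (or_introl erefl) (or_intror erefl).
  apply: (@filterS2 _ _ (ae_filter_ringOfSetsType _) _ _ _ _ h1 h2).
  by move=> t e1 e2 ct; exact: E2_eq (e1 ct) (e2 ct).
split=> //; apply: (@filterS _ _ (ae_filter_ringOfSetsType _) _ _ _ E2E).
by move=> t e ct; exact: E2_regular (e ct).
Qed.
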